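(* Let $G$ be a distinguished group, let $A$ be a simple subgroup of $G$, and for $x,y\in G$ put $H_{xy}=(A.x).(A.y)$. Let $p,q,r\in G$. If $H_{pq}\cap H_{pr}\neq\emptyset$, then $H_{pq}=H_{pr}$.
   Context: A distributive group is a nonempty set $G$ with a binary operation $(a,b)\mapsto a.b$ on $G$ such that for all $a,b\in G$ each of the equations $a.x=b$ and $y.a=b$ has exactly one solution in $G$, and for all $a,b,c\in G$, $(a.b).c=(a.c).(b.c)$ and $c.(a.b)=(c.a).(c.b)$. A subgroup of $G$ is a nonempty subset which is itself a distributive group under the restricted operation; the order is the number of elements. A distributive group is simple if it has no proper subgroup of order greater than one. For subsets $X,Y\subseteq G$ and $p\in G$: $X.Y=\{x.y: x\in X,\,y\in Y\}$, $X.p=\{x.p: x\in X\}$, $p.X=\{p.x:x\in X\}$. A finite distributive group $G$ is called distinguished if for every subgroup $B$ of $G$ and every $p\in G$, the sets $B.(B.p)$ and $(B.p).B$ are subgroups of the same order as $B$; equivalently there are $t,\tau\in G$ with $B.(B.p)=B.t$ and $(B.p).B=B.(p.B)=B.\tau$. *)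

(* Defs.v *)
From mathcomp Require Import all_boot.
Set Implicit Arguments.
Unset Strict Implicit.
Unset Printing Implicit Defensive.

Section DistributiveGroups.
Variables (T : finType) (mul : T -> T -> T).
Implicit Types (S A B X Y : {set T}) (p : T).

(* [S] is a distributive group under the restriction of [mul]; taking
   [S = [set: T]] says that [T] itself is a distributive group. *)
Definition distributive_group S : Prop :=
  [/\ S != set0,
      {in S &, forall a b, mul a b \in S},
      {in S &, forall a b, exists! x, x \in S /\ mul a x = b},
      {in S &, forall a b, exists! y, y \in S /\ mul y a = b}
    & {in S & &, forall a b c,
         mul (mul a b) c = mul (mul a c) (mul b c) /\
         mul c (mul a b) = mul (mul c a) (mul c b)}].

Definition subgroup B S : Prop := B \subset S /\ distributive_group B.

Definition simple S : Prop :=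
  distributive_group S /\
  ~ (exists B, [/\ subgroup B S, B \proper S & 1 < #|B|]).

Definition set_mul X Y : {set T} := [set mul x y | x in X, y in Y].

Definition rtranslate X p : {set T} := [set mul x p | x in X].

Definition distinguished : Prop :=
  distributive_group [set: T] /\
  (forall B p, subgroup B [set: T] ->
     let L := set_mul B (rtranslate B p) in
     let R := set_mul (rtranslate B p) B in
     [/\ subgroup L [set: T], #|L| = #|B|, subgroup R [set: T] & #|R| = #|B|]).

End DistributiveGroups.

(* Main.v *)
Require Import Defs.
From mathcomp Require Import all_boot.
Set Implicit Arguments.
Unset Strict Implicit.
Unset Printing Implicit Defensive.

(** In a distinguished group, each subgroup [B] satisfies [b.(B.x) = b'.(B.x)]
    for [b, b'] in [B]: both sides lie in [B.(B.x)], which has the order of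
    [B].  Since left translations are automorphisms, this forces the right
    translates [B.x] to be pairwise disjoint or equal
    ([rtranslate_eq_of_meet]).  In the same way [c.A = (A.p).A] for every [c]
    in [A.p] ([ltranslate_rtranslate_const]).

    Put [C = A.p].  Suppose that [c.(a.q) = c'.(b.r)] with [c, c'] in [C] and
    [a, b] in [A].  With [R = C.A] one gets [c.(A.q) = R.(c.q)] and
    [c'.(A.r) = R.(c'.r)]; these are two right translates of the subgroup [R]
    with a common point, so [c.(A.q) = c'.(A.r)].  Hence every [d] in [A.q] has
    an [e] in [A.r] with [c.d = c'.e], whence [C.d = C.e] because the right
    translates of [C] are again disjoint or equal.  Taking the union over [d]
    gives [C.(A.q)] inside [C.(A.r)], and the situation is symmetric in [q]
    and [r]. *)

Section DistinguishedGroups.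
Variables (G : finType) (mul : G -> G -> G).
Hypothesis distG : distinguished mul.
Implicit Types (A B : {set G}) (a b c p q r x y : G).

Lemma mulI a : injective (mul a).
Proof.
move=> x y exy; case: distG => -[_ _ + _ _] _.
move=> /(_ a (mul a x) (in_setT _) (in_setT _)) [z [_ uz]].
by rewrite -(uz x) ?(uz y) // exy.
Qed.

Lemma mulIr a : injective (mul^~ a).
Proof.
move=> x y /= exy; case: distG => -[_ _ _ + _] _.
move=> /(_ a (mul x a) (in_setT _) (in_setT _)) [z [_ uz]].
by rewrite -(uz x) ?(uz y) // exy.
Qed.

Lemma mulDr c a b : mul c (mul a b) = mul (mul c a) (mul c b).
Proof.
by case: distG => -[_ _ _ _ D] _; case: (D a b c); rewrite ?in_setT.
Qed.

Lemma mulDl c a b : mul (mul a b) c = mul (mul a c) (mul b c).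
Proof.
by case: distG => -[_ _ _ _ D] _; case: (D a b c); rewrite ?in_setT.
Qed.

Lemma mul_surjr p x : exists y, x = mul y p.
Proof. by case: (injF_bij (@mulIr p)) => f _ fK; exists (f x). Qed.

Lemma card_rtranslate B x : #|rtranslate mul B x| = #|B|.
Proof. exact/card_imset/mulIr. Qed.

(** Left translations are automorphisms, so they carry right translates to
    right translates. *)
Lemma imset_mul_rtranslate a B x :
  mul a @: rtranslate mul B x = rtranslate mul (mul a @: B) (mul a x).
Proof.
by rewrite /rtranslate -!imset_comp; apply: eq_imset => b /=; rewrite mulDr.
Qed.

Lemma rtranslate_mul A p x :
  rtranslate mul (rtranslate mul A p) (mul x p) =
  mul^~ p @: rtranslate mul A x.
Proof.
by rewrite /rtranslate -!imset_comp; apply: eq_imset => b /=; rewrite -mulDl.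
Qed.

Lemma imset_mul_subgroup B a :
  subgroup mul B [set: G] -> a \in B -> mul a @: B = B.
Proof.
case=> _ [_ closedB _ _ _] aB; apply/eqP.
rewrite eqEcard (card_imset _ (@mulI a)) leqnn andbT.
by apply/subsetP => _ /imsetP[b bB ->]; apply: closedB.
Qed.

(** A left factor in [X] that multiplies [Y] into the set [X.Y] fills it as
    soon as [X.Y] is no larger than [Y]. *)
Lemma imset_mul_full (X Y : {set G}) a :
  a \in X -> #|set_mul mul X Y| = #|Y| -> mul a @: Y = set_mul mul X Y.
Proof.
move=> aX cardXY; apply/eqP.
rewrite eqEcard (card_imset _ (@mulI a)) cardXY leqnn andbT.
by apply/subsetP => _ /imsetP[y yY ->]; apply: imset2_f.
Qed.

Lemma ltranslate_rtranslate_const A p c :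
    subgroup mul A [set: G] -> c \in rtranslate mul A p ->
  mul c @: A = set_mul mul (rtranslate mul A p) A.
Proof.
case: distG => _ dG /(dG _ p)[_ _ _ cardR] cC.
exact: imset_mul_full.
Qed.

(** If [a.x = b.y], then [a.(B.x) = B.(a.x) = B.(b.y) = b.(B.y) = a.(B.y)],
    where the last step exchanges left factors from [B]; cancel [a]. *)
Lemma rtranslate_eq_of_meet B x y z :
    subgroup mul B [set: G] ->
    z \in rtranslate mul B x -> z \in rtranslate mul B y ->
  rtranslate mul B x = rtranslate mul B y.
Proof.
move=> sB /imsetP[a aB ->] /imsetP[b bB eab].
have [_ cardL _ _] := distG.2 B y sB.
rewrite -(card_rtranslate B y) in cardL.
apply: (imset_inj (@mulI a)).
rewrite (imset_mul_full aB cardL) -(imset_mul_full bB cardL).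
by rewrite !imset_mul_rtranslate !imset_mul_subgroup // eab.
Qed.

(** Disjoint-or-equal passes from the right translates of [A] to those of
    [A.p], since right translation by [p] is a bijective endomorphism. *)
Lemma rtranslate2_eq_of_meet A p x y z :
    subgroup mul A [set: G] ->
    z \in rtranslate mul (rtranslate mul A p) x ->
    z \in rtranslate mul (rtranslate mul A p) y ->
  rtranslate mul (rtranslate mul A p) x =
  rtranslate mul (rtranslate mul A p) y.
Proof.
move=> sA.
have [[x' ->] [y' ->]] := (mul_surjr p x, mul_surjr p y).
rewrite !rtranslate_mul => /imsetP[z' zx ->] /imsetP[z2 zy /mulIr ez].
by rewrite -ez in zy; rewrite (rtranslate_eq_of_meet sA zx zy).
Qed.

(** The equality [c.(A.q) = c'.(A.r)] holds because both sides are right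
    translates of the one subgroup [(A.p).A = c.A = c'.A]. *)
Lemma set_mul_rtranslate_sub A p q r z :
    subgroup mul A [set: G] ->
    z \in set_mul mul (rtranslate mul A p) (rtranslate mul A q) ->
    z \in set_mul mul (rtranslate mul A p) (rtranslate mul A r) ->
  set_mul mul (rtranslate mul A p) (rtranslate mul A q)
    \subset set_mul mul (rtranslate mul A p) (rtranslate mul A r).
Proof.
move=> sA /imset2P[c d cC dD ->] /imset2P[c' e c'C eE ecd].
have [_ _ sR _] := distG.2 A p sA.
have ecDE : mul c @: rtranslate mul A q = mul c' @: rtranslate mul A r.
  have cd_in := imset_f (mul c) dD; have c'e_in := imset_f (mul c') eE.
  rewrite ecd in cd_in; move: cd_in c'e_in.
  rewrite !imset_mul_rtranslate !(@ltranslate_rtranslate_const _ p) //.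
  exact: rtranslate_eq_of_meet.
apply/subsetP => _ /imset2P[c1 d1 c1C d1D ->].
have : mul c d1 \in mul c' @: rtranslate mul A r by rewrite -ecDE imset_f.
case/imsetP=> e1 e1E ecd1.
have eqC : rtranslate mul (rtranslate mul A p) d1 =
           rtranslate mul (rtranslate mul A p) e1.
  apply: (@rtranslate2_eq_of_meet _ _ _ _ (mul c d1)) => //.
    exact: (imset_f (mul^~ d1)).
  by rewrite ecd1; apply: (imset_f (mul^~ e1)).
have : mul c1 d1 \in rtranslate mul (rtranslate mul A p) e1.
  by rewrite -eqC; apply: (imset_f (mul^~ d1)).
by case/imsetP=> c2 c2C ->; apply: imset2_f.
Qed.

End DistinguishedGroups.

Theorem theorem5p9 (G : finType) (mul : G -> G -> G) (A : {set G})
    (distG : distinguished mul)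
    (subA : subgroup mul A [set: G]) (simpleA : simple mul A) (p q r : G) :
  let H x y := set_mul mul (rtranslate mul A x) (rtranslate mul A y) in
  H p q :&: H p r != set0 -> H p q = H p r.
Proof.
move=> H /set0Pn[z /setIP[zq zr]]; apply/eqP; rewrite eqEsubset.
by rewrite !(set_mul_rtranslate_sub distG subA (z := z)).
Qed.
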